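(* For integers $n\ge2$, as formal power series in $x$, \[ 1+\sum_{k=1}^\infty t^{\star}(\{n\}_k)x^{kn}=\frac{Z_n\!\left(e^{\pi i/n}\frac{x}{2}\right)}{Z_n\!\left(e^{\pi i/n}x\right)}, \] where $Z_n(x)=1+\sum_{k\ge1}\zeta(\{n\}_k)x^{kn}$.
   Context: $\zeta(i_1,\dots,i_k)=\sum_{n_1>\cdots>n_k\ge1}n_1^{-i_1}\cdots n_k^{-i_k}$ for $i_1\ge2$; the $t$-star value is $t^{\star}(i_1,\dots,i_k)=\sum_{n_1\ge\cdots\ge n_k\ge1,\ n_j\text{ odd}}n_1^{-i_1}\cdots n_k^{-i_k}$. $\{n\}_k$ denotes $n$ repeated $k$ times. *)

(* Defs.v *)
From mathcomp Require Import all_boot all_order all_algebra.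
From mathcomp Require Import all_classical all_reals all_analysis.
From mathcomp Require Import complex.
Set Implicit Arguments.
Unset Strict Implicit.
Unset Printing Implicit Defensive.
Import Order.TTheory GRing.Theory Num.Theory.
Local Open Scope classical_set_scope.
Local Open Scope ring_scope.

(* An index (i_1, ..., i_k) is a seq nat, and so is the summation variable
   (n_1, ..., n_k).  All terms are nonnegative, so each multiple series is an
   unordered sum in [0, +oo]; [fine] returns its real value, and returns 0 on
   a divergent series. *)
Section MultipleValues.
Variable R : realType.

Definition mterm (s m : seq nat) : R :=
  \prod_(j < size s) (nth 0%N m j)%:R ^- nth 0%N s j.

Definition mzeta (s : seq nat) : R :=
  fine (\esum_(m in [set m : seq nat |
    [&& size m == size s, sorted gtn m & all (leq 1) m]]) (mterm s m)%:E).

Definition tstar (s : seq nat) : R :=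
  fine (\esum_(m in [set m : seq nat |
    [&& size m == size s, sorted geq m & all odd m]]) (mterm s m)%:E).

Definition cexp (z : R[i]) : R[i] :=
  let: (a +i* b)%C := z in ((expR a * cos b) +i* (expR a * sin b))%C.

End MultipleValues.

(* A formal power series is its sequence of coefficients. *)
Definition fps (K : Type) := nat -> K.

Section FormalPowerSeries.
Variable K : fieldType.
Implicit Types a b q : fps K.

Definition fps_mul a b : fps K := fun N => \sum_(i < N.+1) a i * b (N - i)%N.

(* f(x) |-> f(c x) *)
Definition fps_dilate (c : K) a : fps K := fun N => c ^+ N * a N.

(* 1 + \sum_(k >= 1) c_k x^(k n), for n >= 1: only the indices k <= N can
   contribute to the coefficient of x^N. *)
Definition fps_sparse (n : nat) (c : nat -> K) : fps K :=
  fun N => (N == 0%N)%:R + \sum_(1 <= k < N.+1 | (k * n == N)%N) c k.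

(* Long division: the first N coefficients of a / b, where b 0 != 0. *)
Fixpoint fps_div_seq a b (N : nat) : seq K :=
  if N is M.+1 then
    let s := fps_div_seq a b M in
    rcons s ((a M - \sum_(i < M) s`_i * b (M - i)%N) / b 0%N)
  else [::].

Definition fps_div a b : fps K := fun N => (fps_div_seq a b N.+1)`_N.

Lemma size_fps_div_seq a b N : size (fps_div_seq a b N) = N.
Proof. by elim: N => //= N IH; rewrite size_rcons IH. Qed.

Lemma nth_fps_div_seq a b N i :
  (i < N)%N -> (fps_div_seq a b N)`_i = fps_div a b i.
Proof.
elim: N => // N IH; rewrite ltnS leq_eqVlt => /orP[/eqP -> //|iN].
by rewrite /= nth_rcons size_fps_div_seq iN IH.
Qed.

Lemma fps_divE a b N : fps_div a b N =
  (a N - \sum_(i < N) fps_div a b i * b (N - i)%N) / b 0%N.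
Proof.
rewrite /fps_div /= nth_rcons size_fps_div_seq ltnn eqxx.
by congr ((_ - _) / _); apply: eq_bigr => i _; rewrite nth_fps_div_seq.
Qed.

Lemma fps_divP a b q : b 0%N != 0 -> fps_mul q b = a <-> q = fps_div a b.
Proof.
move=> b0; split=> [<-|->]; apply/funext => N; last first.
  by rewrite /fps_mul big_ord_recr /= subnn fps_divE divfK // addrC subrK.
have [m] := ubnP N; elim: m N => // m IH N; rewrite ltnS => Nm.
rewrite fps_divE {1}/fps_mul big_ord_recr /= subnn.
rewrite [X in _ - X](eq_bigr (fun i : 'I_N => q i * b (N - i)%N)).
  by rewrite addrC addrK mulfK.
by move=> i _; rewrite -IH //; apply: leq_trans Nm.
Qed.

End FormalPowerSeries.

Definition Zseries (R : realType) (n : nat) : fps R[i] :=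
  fps_sparse n (fun k => (mzeta R (nseq k n))%:C%C).

(* Main.v *)
Require Import Defs.
From mathcomp Require Import all_boot all_order all_algebra.
From mathcomp Require Import all_classical all_reals all_analysis.
From mathcomp Require Import complex.
From mathcomp Require Import zify ring lra.
Import Order.TTheory GRing.Theory Num.Theory numFieldNormedType.Exports.
Local Open Scope classical_set_scope.
Local Open Scope ring_scope.

(* Since w^n = -1, Z_n(w x) is the product over m >= 1 of 1 - x^n / m^n, and
   Z_n(w x / 2) is the same product restricted to even m.  The quotient is the
   product over odd m of (1 - x^n / m^n)^-1, whose coefficients are the t-star
   values.  Coefficientwise, this identity is proved for products truncated at
   m <= M by induction on M, and M is then sent to infinity. *)

(** * Finite enumeration of bounded decreasing sequences *)

Fixpoint strict_seqs (P : pred nat) (M k : nat) : seq (seq nat) :=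
  match k, M with
  | 0, _ => [:: [::]]
  | _, 0 => [::]
  | k'.+1, M'.+1 => strict_seqs P M' k'.+1 ++
      (if P M then map (cons M) (strict_seqs P M' k') else [::])
  end.

(** A head equal to [M] may recur in the tail, so that branch keeps [M] and lowers only the length;
    the inner [fix] makes this recursion structural. *)
Fixpoint weak_seqs (P : pred nat) (M : nat) : nat -> seq (seq nat) :=
  fix weak_seqs_M k :=
  match k, M with
  | 0, _ => [:: [::]]
  | _, 0 => [::]
  | k'.+1, M'.+1 => weak_seqs P M' k'.+1 ++
      (if P M then map (cons M) (weak_seqs_M k') else [::])
  end.

Lemma weak_seqs0 P M : weak_seqs P M 0 = [:: [::]]. Proof. by case: M. Qed.

Lemma weak_seqsS P M k : weak_seqs P M.+1 k.+1 = weak_seqs P M k.+1 ++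
  (if P M.+1 then map (cons M.+1) (weak_seqs P M.+1 k) else [::]).
Proof. by []. Qed.

Lemma mem_map_cons (x : nat) (L : seq (seq nat)) m :
  (m \in map (cons x) L) =
  if m is y :: m' then (y == x) && (m' \in L) else false.
Proof.
case: m => [|y m]; first by apply/mapP => -[].
apply/mapP/andP => [[m' m'L [-> ->]]|[/eqP -> mL]]; first by rewrite eqxx.
by exists m.
Qed.

Definition bounded_in (P : pred nat) (M : nat) : pred nat :=
  fun i => P i && (0 < i <= M)%N.

Lemma bounded_in_self P M : bounded_in P M.+1 M.+1 = P M.+1.
Proof. by rewrite /bounded_in leqnn /= andbT. Qed.

Lemma bounded_in_succ P M : bounded_in P M M.+1 = false.
Proof. by rewrite /bounded_in ltnn !andbF. Qed.

Lemma bounded_inS P M i : i != M.+1 -> bounded_in P M.+1 i = bounded_in P M i.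
Proof. by rewrite /bounded_in => iM; case: (P i) => //=; lia. Qed.

Lemma mem_strict_seqs P M k m : (m \in strict_seqs P M k) =
  [&& size m == k, sorted gtn m & all (bounded_in P M) m].
Proof.
elim: M k m => [|M IH] [|k] [|x m] //=.
- by rewrite /bounded_in; case: x => [|x]; rewrite !andbF.
- by rewrite mem_cat IH; case: ifP => // _; rewrite mem_map_cons.
rewrite mem_cat IH /= eqSS (path_sortedE (rev_trans ltn_trans)).
have -> : (x :: m \in (if P M.+1 then map (cons M.+1) (strict_seqs P M k)
    else [::])) = [&& P M.+1, x == M.+1 & m \in strict_seqs P M k].
  by case: ifP => _ //; rewrite mem_map_cons.
(* If the head is [M.+1], strict decrease bounds the tail by [M]; otherwise the sequence can only
   come from the first list. *)
rewrite IH; have [->|xM] := eqVneq x M.+1.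
  rewrite bounded_in_succ bounded_in_self.
  have -> : all (bounded_in P M) m =
      all (gtn M.+1) m && all (bounded_in P M.+1) m.
    rewrite -all_predI; apply: eq_all => i /=; rewrite /bounded_in.
    by case: (P i) => /=; lia.
  by case: (P _); case: (all _ _); case: (sorted _ _); case: (_ == k).
rewrite !andbF orbF bounded_inS //.
case xM1: (bounded_in P M x); last by rewrite !andbF.
(* The tail lies below [x <= M], so the bounds [M] and [M.+1] agree on it. *)
have E : all (gtn x) m && all (bounded_in P M) m =
    all (gtn x) m && all (bounded_in P M.+1) m.
  rewrite -!all_predI; apply: eq_all => i /=; move: xM1; rewrite /bounded_in.
  by case: (P i) => /=; lia.
by case: (all (gtn x) m) E => /= [->|].
Qed.

Lemma mem_weak_seqs P M k m : (m \in weak_seqs P M k) =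
  [&& size m == k, sorted geq m & all (bounded_in P M) m].
Proof.
elim: M k m => [|M IHM] k m.
  case: k m => [|k] [|x m] //=.
  by rewrite /bounded_in; case: x => [|x]; rewrite !andbF.
elim: k m => [|k IH] [|x m] //.
  by rewrite weak_seqsS mem_cat IHM; case: ifP => // _; rewrite mem_map_cons.
rewrite weak_seqsS mem_cat IHM /= eqSS (path_sortedE (rev_trans leq_trans)).
have -> : (x :: m \in (if P M.+1 then map (cons M.+1) (weak_seqs P M.+1 k)
    else [::])) = [&& P M.+1, x == M.+1 & m \in weak_seqs P M.+1 k].
  by case: ifP => _ //; rewrite mem_map_cons.
rewrite IH; have [->|xM] := eqVneq x M.+1.
  rewrite bounded_in_succ bounded_in_self.
  have {1}-> : all (bounded_in P M.+1) m =
      all (geq M.+1) m && all (bounded_in P M.+1) m.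
    rewrite -all_predI; apply: eq_all => i /=; rewrite /bounded_in.
    by case: (P i) => /=; lia.
  by case: (P _); case: (all _ _); case: (sorted _ _); case: (_ == k).
rewrite !andbF orbF bounded_inS //.
case xM1: (bounded_in P M x); last by rewrite !andbF.
have E : all (geq x) m && all (bounded_in P M) m =
    all (geq x) m && all (bounded_in P M.+1) m.
  rewrite -!all_predI; apply: eq_all => i /=; move: xM1; rewrite /bounded_in.
  by case: (P i) => /=; lia.
by case: (all (geq x) m) E => /= [->|].
Qed.

Lemma uniq_cat_map_cons (L1 L2 : seq (seq nat)) x :
  uniq L1 -> uniq L2 -> (forall m, x :: m \notin L1) ->
  uniq (L1 ++ map (cons x) L2).
Proof.
move=> uL1 uL2 xL1.
rewrite cat_uniq uL1 map_inj_uniq ?uL2 ?andbT; last by move=> ? ? [].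
by apply/hasPn => _ /mapP[m _ ->]; exact: xL1.
Qed.

Lemma strict_seqs_uniq P M k : uniq (strict_seqs P M k).
Proof.
elim: M k => [|M IH] [|k] //=; case: ifP => _; last by rewrite cats0.
apply: uniq_cat_map_cons => // m.
by rewrite mem_strict_seqs /= /bounded_in ltnn !andbF.
Qed.

Lemma weak_seqs_uniq P M k : uniq (weak_seqs P M k).
Proof.
elim: M k => [|M IHM]; first by case.
elim=> [|k IHk] //; rewrite weak_seqsS; case: ifP => _; last by rewrite cats0.
apply: uniq_cat_map_cons => // m.
by rewrite mem_weak_seqs /= /bounded_in ltnn !andbF.
Qed.

(** * Symmetric polynomials and the truncated product identity *)

Section SymmetricSums.
Variable R : fieldType.
Implicit Types (P : pred nat) (a : nat -> R).

(** The elementary symmetric polynomial e_k: the coefficient of x^k in the product of 1 + a_i x over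
    1 <= i <= M in [P]. *)
Definition elem_sum P a M k : R :=
  \sum_(m <- strict_seqs P M k) \prod_(i <- m) a i.

(** The complete homogeneous polynomial h_k: the coefficient of x^k in the product of (1 - a_i x)^-1
    over the same indices. *)
Definition compl_sum P a M k : R :=
  \sum_(m <- weak_seqs P M k) \prod_(i <- m) a i.

Lemma sum_if_map_cons (b : bool) x a (L : seq (seq nat)) :
  \sum_(m <- if b then map (cons x) L else [::]) \prod_(i <- m) a i =
  b%:R * a x * \sum_(m <- L) \prod_(i <- m) a i.
Proof.
case: b; last by rewrite big_nil mul0r mul0r.
rewrite big_map big_distrr /=; apply: eq_bigr => m _.
by rewrite big_cons mul1r.
Qed.

Lemma elem_sum_0 P a M : elem_sum P a M 0 = 1.
Proof. by case: M => [|M]; rewrite /elem_sum /= big_seq1 big_nil. Qed.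

Lemma elem_sum_0S P a k : elem_sum P a 0 k.+1 = 0.
Proof. by rewrite /elem_sum big_nil. Qed.

Lemma elem_sumSS P a M k : elem_sum P a M.+1 k.+1 =
  elem_sum P a M k.+1 + (P M.+1)%:R * a M.+1 * elem_sum P a M k.
Proof. by rewrite /elem_sum /= big_cat /= sum_if_map_cons. Qed.

Lemma compl_sum_0 P a M : compl_sum P a M 0 = 1.
Proof. by rewrite /compl_sum weak_seqs0 big_seq1 big_nil. Qed.

Lemma compl_sum_0S P a k : compl_sum P a 0 k.+1 = 0.
Proof. by rewrite /compl_sum big_nil. Qed.

Lemma compl_sumSS P a M k : compl_sum P a M.+1 k.+1 =
  compl_sum P a M k.+1 + (P M.+1)%:R * a M.+1 * compl_sum P a M.+1 k.
Proof. by rewrite /compl_sum weak_seqsS big_cat /= sum_if_map_cons. Qed.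

Lemma fps_mulC (f g : fps R) k : fps_mul f g k = fps_mul g f k.
Proof.
rewrite /fps_mul (reindex_inj rev_ord_inj) /=; apply: eq_bigr => i _.
by rewrite subSS mulrC subKn // -ltnS.
Qed.

(** The hypotheses encode f' = f + c x h, to be multiplied by g; one factor of a truncated product
    is added this way. *)
Lemma fps_mul_shiftl (c : R) (f' f h g : fps R) k :
  f' 0%N = f 0%N -> (forall i, f' i.+1 = f i.+1 + c * h i) ->
  fps_mul f' g k.+1 = fps_mul f g k.+1 + c * fps_mul h g k.
Proof.
move=> f0 fS; rewrite /fps_mul big_ord_recl [in RHS]big_ord_recl /= f0 -addrA.
congr (_ + _); rewrite big_distrr /= -big_split /=; apply: eq_bigr => i _.
by rewrite !/bump /= fS subSS mulrDl mulrA.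
Qed.

Lemma fps_mul_shiftr (c : R) (f g' g h : fps R) k :
  g' 0%N = g 0%N -> (forall i, g' i.+1 = g i.+1 + c * h i) ->
  fps_mul f g' k.+1 = fps_mul f g k.+1 + c * fps_mul f h k.
Proof.
move=> g0 gS.
by rewrite fps_mulC (fps_mul_shiftl _ _ _ _ _ _ g0 gS) !(fps_mulC _ f).
Qed.

(* The factors 1 - a_m x of the second product that are indexed by P cancel
   against those of \prod_(m | P m) (1 - a_m x)^-1. *)
Lemma fps_mul_compl_elem P a M k :
  fps_mul (compl_sum P a M) (elem_sum predT (fun i => - a i) M) k =
  elem_sum (predC P) (fun i => - a i) M k.
Proof.
elim: M k => [|M IH] [|k].
- by rewrite /fps_mul big_ord1 compl_sum_0 !elem_sum_0 mulr1.
- rewrite elem_sum_0S /fps_mul big1 // => -[[|i] /= ik] _.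
    by rewrite elem_sum_0S mulr0.
  by rewrite compl_sum_0S mul0r.
- by rewrite /fps_mul big_ord1 compl_sum_0 !elem_sum_0 mulr1.
pose E := elem_sum predT (fun i => - a i).
(* Split off the factor 1 - a_{M+1} x on the right, then the inverse factor, if present, on the
   left. *)
rewrite (@fps_mul_shiftr (- a M.+1) _ _ (E M) (E M)); last 2 first.
- by rewrite /E !elem_sum_0.
- by move=> i; rewrite /E elem_sumSS mul1r.
rewrite (@fps_mul_shiftl ((P M.+1)%:R * a M.+1) _ (compl_sum P a M)
  (compl_sum P a M.+1)); last 2 first.
- by rewrite !compl_sum_0.
- by move=> i; rewrite compl_sumSS.
rewrite IH elem_sumSS /= -/(E M) -addrA; congr (_ + _).
(* When [P M.+1] holds, the two new contributions cancel. Otherwise [compl_sum] is the same at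
   [M.+1] as at [M], and [IH] applies once more. *)
case PM: (P M.+1) => /=.
  by rewrite mul1r mulNr subrr mul0r mul0r.
rewrite !mul0r add0r mul1r -IH; congr (_ * fps_mul _ _ _).
apply/funext => -[|i]; first by rewrite !compl_sum_0.
by rewrite compl_sumSS PM !mul0r addr0.
Qed.

Lemma elem_sum_scale P (c : R) a M k :
  elem_sum P (fun i => c * a i) M k = c ^+ k * elem_sum P a M k.
Proof.
rewrite /elem_sum big_distrr /= !big_seq; apply: eq_bigr => m.
rewrite mem_strict_seqs => /and3P[/eqP <- _ _].
by rewrite big_split /= big_const_seq count_predT iter_mulr_1.
Qed.

(** Each step of [M] adds the index 2M+1, which [predC odd] rejects, and 2M+2, which matches the new
    index M+1 on the right. *)
Lemma elem_sum_even a M k :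
  elem_sum (predC odd) a M.*2 k = elem_sum predT (fun i => a i.*2) M k.
Proof.
elim: M k => [|M IH] [|k]; rewrite ?elem_sum_0 ?elem_sum_0S //.
rewrite doubleS !elem_sumSS /= odd_double /= !IH !mul0r addr0 !mul1r.
congr (_ + _ * _); case: k => [|k]; first by rewrite !elem_sum_0.
by rewrite elem_sumSS /= odd_double /= IH !mul0r addr0.
Qed.

End SymmetricSums.

Arguments elem_sum {R}.
Arguments compl_sum {R}.

(** * Unordered sums as limits, and uniform bounds *)

Section Limits.
Variable R : realType.

Lemma sum_le_subset (T : choiceType) (L1 L2 : seq T) (f : T -> R) :
  (forall x, 0 <= f x) -> uniq L1 -> uniq L2 -> {subset L1 <= L2} ->
  \sum_(x <- L1) f x <= \sum_(x <- L2) f x.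
Proof.
move=> f0 uL1 uL2 L12; rewrite [leRHS](bigID (mem L1)) /=.
rewrite [X in _ <= X + _](_ : _ = \sum_(x <- L1) f x).
  by rewrite lerDl sumr_ge0.
rewrite -big_filter; apply/perm_big/uniq_perm; rewrite ?filter_uniq // => x.
by rewrite mem_filter /=; case: (boolP (x \in L1)) => // /L12 ->.
Qed.

(** The lists increase and every finite subset of [S] lies in one of them, so the unordered sum is
    the supremum of the list sums. The bound [C] keeps it finite, so [fine] does not fall back to
    0. *)
Lemma cvg_sum_esum (T : choiceType) (L : nat -> seq T) (S : set T)
    (f : T -> R) (C : R) :
  (forall x, 0 <= f x) -> (forall M, uniq (L M)) ->
  {homo L : M N / (M <= N)%N >-> {subset M <= N}} ->
  (forall x, S x <-> exists M, x \in L M) ->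
  (forall M, \sum_(x <- L M) f x <= C) ->
  \sum_(x <- L M) f x @[M --> \oo] --> fine (\esum_(x in S) (f x)%:E).
Proof.
move=> f0 uL homoL SL bndL; pose u M := \sum_(x <- L M) f x.
have ndu : nondecreasing_seq u.
  by move=> M N MN; apply: sum_le_subset => //; exact: homoL.
have cvu : cvgn u.
  by apply: nondecreasing_is_cvgn => //; exists C => _ [M _ <-]; exact: bndL.
(* After this rewriting the goal is convertible to [cvu]. *)
suff -> : \esum_(x in S) (f x)%:E = (limn u)%:E by [].
apply/eqP; rewrite eq_le; apply/andP; split.
  apply: ge_ereal_sup => _ [X [finX XS] <-].
  rewrite fsumEFin // lee_fin fsbig_finite //=.
  (* A common [M] for the finite set is the maximum of the indices found for its elements. *)
  have [M XM] : exists M, {subset (finmap.enum_fset (fset_set X)) <= L M}.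
    have : {in (finmap.enum_fset (fset_set X)), forall x, S x}.
      by move=> x; rewrite in_fset_set // inE => /XS.
    elim: (finmap.enum_fset (fset_set X)) => [|x s IH] sS; first by exists 0%N.
    have [|M sM] := IH; first by move=> y ys; apply: sS; rewrite inE ys orbT.
    have /SL[N xN] : S x by apply: sS; rewrite mem_head.
    exists (maxn M N) => y; rewrite inE => /predU1P[->|/sM].
      by apply: homoL xN; rewrite leq_maxr.
    by apply: homoL; rewrite leq_maxl.
  apply: le_trans (nondecreasing_cvgn_le ndu cvu M).
  by apply: sum_le_subset => //; exact: fset_uniq.
rewrite -EFin_lim //; apply: lime_le.
  by apply/ereal_nondecreasing_is_cvgn => M N /ndu; rewrite lee_fin.
apply: nearW => M; apply: esum_ge; exists [set` L M]; last first.
  by rewrite -fsbig_seq //= sumEFin.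
by split=> [|x /= xL]; [exact: finite_seq|apply/SL; exists M].
Qed.

Variable P : pred nat.
Variable a : nat -> R.
Hypothesis a_ge0 : forall i, 0 <= a i.
Let A M := \sum_(1 <= i < M.+1) a i.

Let A_ge0 M : 0 <= A M. Proof. exact: sumr_ge0. Qed.

Let AS M : A M.+1 = A M + a M.+1. Proof. by rewrite /A big_nat_recr. Qed.

Let Pa_le M : (P M)%:R * a M <= a M.
Proof. by case: (P M); rewrite ?mul1r ?mul0r. Qed.

(** The two terms of [elem_sumSS] are matched with the two summands of [A M.+1 = A M + a M.+1] in
    one factor of the power. *)
Lemma elem_sum_le M k : elem_sum P a M k <= A M ^+ k.
Proof.
elim: M k => [|M IH] [|k]; rewrite ?elem_sum_0 ?expr0 //.
  by rewrite elem_sum_0S exprn_ge0.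
rewrite elem_sumSS AS exprS mulrDl lerD //.
  rewrite (le_trans (IH _)) // exprS ler_wpM2l // lerXn2r ?nnegrE ?addr_ge0 //.
  by rewrite lerDl.
have e0 : 0 <= elem_sum P a M k.
  by rewrite sumr_ge0 // => m _; rewrite prodr_ge0.
rewrite ler_pM ?mulr_ge0 // (le_trans (IH _)) // lerXn2r ?nnegrE ?addr_ge0 //.
by rewrite lerDl.
Qed.

Lemma compl_sum_le M k : compl_sum P a M k <= A M ^+ k.
Proof.
elim: M k => [|M IHM].
  by case=> [|k]; rewrite ?compl_sum_0 ?expr0 // compl_sum_0S exprn_ge0.
elim=> [|k IHk]; first by rewrite compl_sum_0 expr0.
rewrite compl_sumSS AS exprS mulrDl lerD //.
  rewrite (le_trans (IHM _)) // exprS ler_wpM2l // lerXn2r ?nnegrE ?addr_ge0 //.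
  by rewrite lerDl.
rewrite -AS ler_pM ?mulr_ge0 //.
by rewrite sumr_ge0 // => m _; rewrite prodr_ge0.
Qed.

End Limits.

(** * Convergence to multiple zeta and t-star values *)

Lemma sum_inv_sqr_le (R : realType) M :
  \sum_(1 <= i < M.+1) (i%:R ^- 2 : R) <= 2.
Proof.
case: M => [|M]; first by rewrite big_geq.
(* The sharper bound makes the induction go through: (m+1)^-2 is at most 1/m - 1/(m+1). *)
suff : \sum_(1 <= i < M.+2) (i%:R ^- 2 : R) <= 2 - M.+1%:R^-1.
  by move=> /le_trans; apply; rewrite gerBl invr_ge0.
elim: M => [|M IH]; first by rewrite big_nat1 expr1n invr1; lra.
rewrite big_nat_recr //= (le_trans (lerD IH (lexx _))) //.
rewrite -[M.+2%:R]natr1; set x : R := M.+1%:R.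
have : 0 < x by rewrite ltr0n.
move: x => x x0.
have -> : 2 - x^-1 + (x + 1) ^- 2 = 2 - (x + 1)^-1 - x^-1 * (x + 1) ^- 2.
  by field; rewrite !gt_eqF // addr_gt0.
by rewrite gerBl mulr_ge0 // invr_ge0 ?exprn_ge0 ?addr_ge0 // ltW.
Qed.

Section Values.
Variables (R : realType) (n : nat).
Hypothesis n_ge2 : (2 <= n)%N.
Let a : nat -> R := fun i => i%:R ^- n.

Let a_ge0 i : 0 <= a i. Proof. by rewrite invr_ge0 exprn_ge0. Qed.

Let A_le M : \sum_(1 <= i < M.+1) a i <= 2.
Proof.
apply: le_trans (sum_inv_sqr_le R M); apply: ler_sum_nat => i /andP[i0 _].
by rewrite lef_pV2 ?posrE ?exprn_gt0 ?ltr0n // ler_weXn2l // ler1n.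
Qed.

Lemma mterm_nseq k (m : seq nat) :
  size m = k -> mterm R (nseq k n) m = \prod_(i <- m) a i.
Proof.
move=> <-; rewrite /mterm size_nseq (big_nth 0%N) big_mkord.
by apply: eq_bigr => i _; rewrite nth_nseq ltn_ord.
Qed.

Let mterm_ge0 s m : 0 <= mterm R s m.
Proof. by apply: prodr_ge0 => i _; rewrite invr_ge0 exprn_ge0. Qed.

Let seq_bounded (m : seq nat) : exists M, all (fun i => (i <= M)%N) m.
Proof.
exists (\max_(i <- m) i)%N; apply/allP => i im.
by rewrite (big_rem i) //= leq_maxl.
Qed.

Lemma elem_sum_cvg k :
  elem_sum predT a M k @[M --> \oo] --> mzeta R (nseq k n).
Proof.
have -> : (fun M => elem_sum predT a M k) =
    fun M => \sum_(m <- strict_seqs predT M k) mterm R (nseq k n) m.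
  apply/funext => M; apply: eq_big_seq => m.
  by rewrite mem_strict_seqs => /and3P[/eqP mk _ _]; rewrite mterm_nseq.
(* The constant comes from [elem_sum_le] and the bound 2 of [A_le], uniform in [M]. *)
apply: (@cvg_sum_esum _ _ _ _ _ (2 ^+ k)) => //.
- by move=> M; exact: strict_seqs_uniq.
- move=> M N MN m; rewrite !mem_strict_seqs => /and3P[-> -> /=].
  apply: sub_all => i /andP[_ /andP[i0 iM]].
  by rewrite /bounded_in i0 (leq_trans iM).
- move=> m; rewrite /= size_nseq; split=> [/and3P[mk ms m1]|[M]].
    have [M mM] := seq_bounded m; exists M; rewrite mem_strict_seqs mk ms /=.
    apply/allP => i im; rewrite /bounded_in /=.
    by rewrite (allP m1 _ im) (allP mM _ im).
  rewrite mem_strict_seqs => /and3P[-> -> /=].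
  by apply: sub_all => i /andP[_ /andP[]].
- move=> M; rewrite (eq_big_seq (fun m => \prod_(i <- m) a i)).
    apply: le_trans (elem_sum_le _ _ _ a_ge0 _ _) _.
    by rewrite lerXn2r ?nnegrE ?sumr_ge0.
  move=> m; rewrite mem_strict_seqs => /and3P[/eqP mk _ _].
  by rewrite mterm_nseq.
Qed.

Lemma compl_sum_cvg k :
  compl_sum odd a M k @[M --> \oo] --> tstar R (nseq k n).
Proof.
have E M : compl_sum odd a M k =
    \sum_(m <- weak_seqs odd M k) mterm R (nseq k n) m.
  apply: eq_big_seq => m.
  by rewrite mem_weak_seqs => /and3P[/eqP mk _ _]; rewrite mterm_nseq.
under eq_fun do rewrite E.
apply: (@cvg_sum_esum _ _ _ _ _ (2 ^+ k)) => //.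
- by move=> M; exact: weak_seqs_uniq.
- move=> M N MN m; rewrite !mem_weak_seqs => /and3P[-> -> /=].
  apply: sub_all => i /and3P[? i0 iM].
  by rewrite /bounded_in i0 (leq_trans iM) ?andbT.
- move=> m; rewrite /= size_nseq; split=> [/and3P[mk ms mo]|[M]].
    have [M mM] := seq_bounded m; exists M; rewrite mem_weak_seqs mk ms /=.
    apply/allP => i im; rewrite /bounded_in (allP mo _ im) (allP mM _ im).
    by rewrite odd_gt0 // (allP mo).
  rewrite mem_weak_seqs => /and3P[-> -> /=].
  by apply: sub_all => i /andP[].
- move=> M; rewrite -E; apply: le_trans (compl_sum_le _ _ _ a_ge0 _ _) _.
  by rewrite lerXn2r ?nnegrE ?sumr_ge0.
Qed.

(** Two computations of the limit of one finite convolution [u]: its factors converge separately,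
    while at truncation 2M cancellation leaves the even indices, where (2i)^-n = 2^-n i^-n. *)
Lemma fps_mul_tstar_mzeta k :
  fps_mul (fun j => tstar R (nseq j n))
    (fun j => (-1) ^+ j * mzeta R (nseq j n)) k = (- 2 ^- n) ^+ k * mzeta R (nseq k n).
Proof.
(* Needed for [c] equal to -1 in the factors of [u], and to -2^-n for the even indices. *)
have ecvg (c : R) j : elem_sum predT (fun i => c * a i) M j @[M --> \oo] -->
    c ^+ j * mzeta R (nseq j n).
  under eq_fun do rewrite elem_sum_scale.
  by apply: cvgM; [exact: cvg_cst|exact: elem_sum_cvg].
pose u M := fps_mul (compl_sum odd a M) (elem_sum predT (fun i => - a i) M) k.
have ucvg : u M @[M --> \oo] --> fps_mul (fun j => tstar R (nseq j n))
    (fun j => (-1) ^+ j * mzeta R (nseq j n)) k.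
  apply: cvg_big => [|i _]; first exact: add_continuous.
  apply: cvgM; first exact: compl_sum_cvg.
  have -> : (fun i => - a i) = (fun i => -1 * a i).
    by apply/funext => j; rewrite mulN1r.
  exact: ecvg.
have u2 M : u (2 * M)%N = elem_sum predT (fun i => - 2 ^- n * a i) M k.
  rewrite /u mul2n fps_mul_compl_elem elem_sum_even; congr elem_sum.
  by apply/funext => i; rewrite /a -muln2 natrM exprMn invfM mulNr mulrC.
(* The subsequence at 2M has the same limit as [u]; uniqueness of limits then gives the identity. *)
have u2cvg := cvg_comp _ _ (@cvg_mulnl 2 isT) ucvg.
rewrite -(cvg_lim _ u2cvg) //; apply: cvg_lim => //.
rewrite (_ : _ \o _ = fun M => elem_sum predT (fun i => - 2 ^- n * a i) M k).
  exact: ecvg.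
by apply/funext => M; exact: u2.
Qed.

End Values.

Lemma tstar_nil (R : realType) : tstar R [::] = 1.
Proof.
(* Any exponent at least 2 would do: [nseq 0 2] is the empty index, with all truncated sums equal to
   1. *)
have /cvg_lim <- // := @compl_sum_cvg R 2 isT 0.
by under eq_fun do rewrite compl_sum_0; rewrite lim_cst.
Qed.

Lemma mzeta_nil (R : realType) : mzeta R [::] = 1.
Proof.
have /cvg_lim <- // := @elem_sum_cvg R 2 isT 0.
by under eq_fun do rewrite elem_sum_0; rewrite lim_cst.
Qed.

(** * Power series in x^n *)

Section SparseSeries.
Variables (K : fieldType) (n : nat).
Hypothesis n_gt0 : (0 < n)%N.
Implicit Types c d : nat -> K.

(** With [c 0 = 1], the separately written constant term becomes the case k = 0 of the general
    coefficient. *)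
Lemma fps_sparseE c N : c 0%N = 1 ->
  fps_sparse n c N = if (n %| N)%N then c (N %/ n)%N else 0.
Proof.
move=> c0; rewrite /fps_sparse; have [->|N0] := posnP N.
  by rewrite dvdn0 div0n c0 big_geq ?addr0.
rewrite add0r big_mkcond /=; case: ifP => [|nN].
  move=> /dvdnP[k Nk].
  have k0 : (0 < k)%N by move: N0; rewrite Nk muln_gt0 => /andP[].
  rewrite [in RHS]Nk mulnK // (bigD1_seq k) ?iota_uniq //=; last first.
    by rewrite mem_index_iota k0 Nk ltnS leq_pmulr.
  rewrite Nk eqxx big1 ?addr0 // => j jk.
  by rewrite eqn_pmul2r // (negbTE jk).
rewrite big1 // => j _; case: eqP => // jN.
by rewrite -jN dvdn_mull in nN.
Qed.

Lemma sum_dvdn (F : nat -> K) k :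
  \sum_(i < (k * n).+1 | (n %| i)%N) F i = \sum_(j < k.+1) F (j * n)%N.
Proof.
rewrite -(big_mkord (fun i => n %| i)%N).
rewrite -(big_mkord predT (fun j => F (j * n)%N)).
elim: k => [|k IH]; first by rewrite mul0n big_mkcond !big_nat1 dvdn0.
rewrite big_mkcond /= (big_cat_nat (n := (k * n).+1)) //=; last first.
  by rewrite ltnS leq_mul2r leqnSn orbT.
rewrite -big_mkcond /= IH [RHS]big_nat_recr //=; congr (_ + _).
(* Among the indices above kn and up to (k+1)n, only the last is a multiple of n. *)
have -> : (k.+1 * n = k * n + n)%N by rewrite mulSn addnC.
rewrite big_nat_recr /=; last by rewrite -addn1 leq_add2l.
rewrite dvdn_addr ?dvdn_mull // dvdnn big_nat_cond big1 ?add0r // => i.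
rewrite andbT => /andP[ki ik].
rewrite -(subnKC (ltnW ki)) dvdn_addr ?dvdn_mull // gtnNdvd //.
  by rewrite subn_gt0.
by rewrite ltn_subLR // ltnW.
Qed.

Lemma fps_mul_sparse c d : c 0%N = 1 -> d 0%N = 1 ->
  fps_mul (fps_sparse n c) (fps_sparse n d) = fps_sparse n (fps_mul c d).
Proof.
move=> c0 d0; apply/funext => N; rewrite [RHS]fps_sparseE; last first.
  by rewrite /fps_mul big_ord1 c0 d0 mulr1.
rewrite {1}/fps_mul.
have E i : fps_sparse n c i * fps_sparse n d (N - i)%N =
    if (n %| i)%N then c (i %/ n)%N * fps_sparse n d (N - i)%N else 0.
  by rewrite fps_sparseE //; case: ifP => // _; rewrite mul0r.
under eq_bigr do rewrite E.
rewrite -big_mkcond /=; case: ifPn => [/dvdnP[k ->]|nN].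
  rewrite (sum_dvdn (fun i => c (i %/ n)%N * fps_sparse n d (k * n - i)%N)).
  rewrite mulnK //; apply: eq_bigr => j _.
  by rewrite -mulnBl fps_sparseE // dvdn_mull // !mulnK.
(* Here [n] divides [i] but not [N], hence not [N - i]. *)
rewrite big1 // => i ni; rewrite fps_sparseE // ifF ?mulr0 //.
by apply/negbTE; rewrite dvdn_subl // -ltnS.
Qed.

Lemma fps_dilate_sparse w c : c 0%N = 1 ->
  fps_dilate w (fps_sparse n c) = fps_sparse n (fun k => (w ^+ n) ^+ k * c k).
Proof.
move=> c0; apply/funext => N; rewrite /fps_dilate !fps_sparseE ?c0 ?mulr1 //.
case: ifP => [nN|_]; last by rewrite mulr0.
by rewrite -exprM mulnC divnK.
Qed.

End SparseSeries.

(** * The root of -1 and the quotient formula *)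

Lemma cexp_pi_div_expn (R : realType) (n : nat) : (0 < n)%N ->
  cexp ((pi : R)%:C%C * 'i%C / n%:R) ^+ n = -1.
Proof.
move=> n0; pose t : R := pi / n%:R.
have -> : (pi : R)%:C%C * 'i%C / n%:R = (0 +i* t)%C.
  rewrite -(rmorph_nat (real_complex R)) -fmorphV mulrAC -rmorphM /= -/t.
  by apply/eqP; rewrite eq_complex /=; apply/andP; split; apply/eqP; ring.
rewrite /cexp expR0 !mul1r.
(* De Moivre's formula, from the addition formulas. *)
have dM m : ((cos t +i* sin t)%C : R[i]) ^+ m =
    (cos (t *+ m) +i* sin (t *+ m))%C.
  elim: m => [|m IH]; first by rewrite expr0 mulr0n cos0 sin0.
  rewrite exprS IH mulrS cosD sinD; apply/eqP; rewrite eq_complex /=.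
  by apply/andP; split; apply/eqP; ring.
rewrite dM -mulr_natr /t divfK ?pnatr_eq0 -?lt0n // cospi sinpi.
by apply/eqP; rewrite eq_complex /= oppr0 !eqxx.
Qed.

Theorem theorem2p11 (R : realType) (n : nat) (hn : (2 <= n)%N) :
  let w : R[i] := cexp ((pi : R)%:C%C * 'i%C / n%:R) in
  fps_sparse n (fun k => (tstar R (nseq k n))%:C%C) =
  fps_div (fps_dilate (w / 2%:R) (Zseries R n)) (fps_dilate w (Zseries R n)).
Proof.
move=> w; have n0 : (0 < n)%N by exact: ltnW.
have wn : w ^+ n = -1 by exact: cexp_pi_div_expn.
have t0 : (tstar R (nseq 0 n))%:C%C = 1 by rewrite tstar_nil.
have z0 : (mzeta R (nseq 0 n))%:C%C = 1 by rewrite mzeta_nil.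
(* The quotient becomes a product identity, and sparseness reduces it to the coefficients of
   x^(kn). *)
rewrite /Zseries !fps_dilate_sparse //; apply/fps_divP.
  by rewrite fps_sparseE // ?dvdn0 ?div0n mul1r z0 ?oner_neq0.
rewrite fps_mul_sparse //; last by rewrite mul1r.
congr fps_sparse; apply/funext => k.
have -> : (w / 2%:R) ^+ n = (- 2 ^- n : R)%:C%C.
  by rewrite expr_div_n wn rmorphN fmorphV rmorphXn rmorph_nat mulN1r.
(* Only w^n = -1 remains of [w], so the identity is the image of the real one under the embedding
   into [R[i]]. *)
rewrite -rmorphXn -rmorphM -(fps_mul_tstar_mzeta _ _ hn) rmorph_sum.
apply: eq_bigr => i _; rewrite wn.
by rewrite !rmorphM rmorphXn rmorphN1.
Qed.
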